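(* Let $\lambda\in\mathbb C^*$ and $h(t)\in\mathbb C[t]$. The set $\{\mathcal S_{f(t)}+\mathcal S_{sg(t)}\mid f(t),g(t)\in\mathbb C[t]\}$ exhausts all $W(0,1)$-submodules of $\Theta(\lambda,h)$.
   Context: $W(0,1)$ is the complex Lie algebra with basis $\{L_m,W_m\mid m\in\mathbb Z\}$ and brackets $[L_m,L_n]=(n-m)L_{m+n}$, $[L_m,W_n]=(n+m)W_{m+n}$, $[W_m,W_n]=0$. For $\lambda\in\mathbb C^*$, $h=h(t)\in\mathbb C[t]$, the $W(0,1)$-module $\Theta(\lambda,h)$ is the polynomial space $\mathbb C[s,t]$ with action $$L_mf(s,t)=\lambda^m\big(s+mh(t)\big)f(s-m,t),\qquad W_mf(s,t)=\delta_{m,0}\,t f(s,t)$$ for $m\in\mathbb Z$, $f(s,t)\in\mathbb C[s,t]$. For $f(s,t)\in\mathbb C[s,t]$, $\mathcal S_{f(s,t)}$ denotes the $W(0,1)$-submodule of $\Theta(\lambda,h)$ generated by $f(s,t)$. *)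

(* Defs.v *)
From HB Require Import structures.
From mathcomp Require Import all_boot all_order all_algebra.
From mathcomp Require Import finmap boolp classical_sets reals complex monalg.
From mathcomp Require Import ring.

Set Implicit Arguments.
Unset Strict Implicit.
Unset Printing Implicit Defensive.

Import GRing.Theory Num.Theory.
Local Open Scope ring_scope.

HB.mixin Record Lmodule_isLieAlgebra (K : fieldType) L of GRing.Lmodule K L := {
  lie_bracket : L -> L -> L;
  lie_bracketPl : forall (a : K) (x y z : L),
    lie_bracket (a *: x + y) z = a *: lie_bracket x z + lie_bracket y z;
  lie_bracketPr : forall (a : K) (x y z : L),
    lie_bracket x (a *: y + z) = a *: lie_bracket x y + lie_bracket x z;
  lie_bracketxx : forall x : L, lie_bracket x x = 0;
  lie_jacobi : forall x y z : L,
    lie_bracket x (lie_bracket y z) + lie_bracket y (lie_bracket z x)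
      + lie_bracket z (lie_bracket x y) = 0
}.

#[short(type="lieAlgType")]
HB.structure Definition LieAlgebra (K : fieldType) :=
  {L of GRing.Lmodule K L & Lmodule_isLieAlgebra K L}.

HB.mixin Record Lmodule_isLieModule (K : fieldType) (L : lieAlgType K) V
    of GRing.Lmodule K V := {
  lie_act : L -> V -> V;
  lie_actPl : forall (a : K) (x y : L) (v : V),
    lie_act (a *: x + y) v = a *: lie_act x v + lie_act y v;
  lie_actPr : forall (a : K) (x : L) (u v : V),
    lie_act x (a *: u + v) = a *: lie_act x u + lie_act x v;
  lie_act_bracket : forall (x y : L) (v : V),
    lie_act (lie_bracket x y) v
      = lie_act x (lie_act y v) - lie_act y (lie_act x v)
}.

#[short(type="lieModType")]
HB.structure Definition LieModule (K : fieldType) (L : lieAlgType K) :=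
  {V of GRing.Lmodule K V & Lmodule_isLieModule K L V}.

Section Submodules.
Local Open Scope classical_set_scope.
Variables (K : fieldType) (L : lieAlgType K) (V : lieModType L).

Definition lie_submodule (M : set V) : Prop :=
  [/\ M 0,
      forall (a : K) (u v : V), M u -> M v -> M (a *: u + v)
    & forall (x : L) (v : V), M v -> M (lie_act x v)].

Definition generated_submodule (v : V) : set V :=
  smallest lie_submodule [set v].

Definition submodule_sum (M N : set V) : set V :=
  [set u + v | u in M & v in N].

End Submodules.

(* Linear extension to the free module on I of a family indexed by I. *)
Section LinearExtension.
Variables (K : fieldType) (I : choiceType) (V : lmodType K).

Definition lin_ext (F : I -> V) (x : {malg K[I]}) : V :=
  \sum_(k <- msupp x) x@_k *: F k.

Lemma lin_extEw F (x : {malg K[I]}) (D : {fset I}) :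
  (msupp x `<=` D)%fset -> lin_ext F x = \sum_(k <- D) x@_k *: F k.
Proof.
move=> sD; rewrite /lin_ext (big_fset_incl _ sD) // => k _ kx.
by rewrite mcoeff_outdom // scale0r.
Qed.

Lemma lin_extP F (a : K) (x y : {malg K[I]}) :
  lin_ext F (a *: x + y) = a *: lin_ext F x + lin_ext F y.
Proof.
pose D := (msupp x `|` msupp y `|` msupp (a *: x + y))%fset.
rewrite !(@lin_extEw _ _ D);
  try by apply/fsubsetP => k; rewrite !in_fsetE => ->; rewrite ?orbT.
rewrite scaler_sumr -big_split /=; apply: eq_bigr => k _.
by rewrite mcoeffD mcoeffZ scalerDl scalerA.
Qed.

Lemma lin_extU F k : lin_ext F << k >> = F k.
Proof.
rewrite (@lin_extEw _ _ [fset k]%fset) ?msuppU_le //.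
by rewrite big_seq_fset1 mcoeffUU scale1r.
Qed.

Lemma lin_ext0 F : lin_ext F 0 = 0.
Proof. by rewrite /lin_ext msupp0 big_seq_fset0. Qed.

Lemma lin_extD F x y : lin_ext F (x + y) = lin_ext F x + lin_ext F y.
Proof. by rewrite -[x in LHS]scale1r lin_extP scale1r. Qed.

Lemma lin_extZ F a x : lin_ext F (a *: x) = a *: lin_ext F x.
Proof. by rewrite -[a *: x]addr0 lin_extP lin_ext0 addr0. Qed.

Lemma lin_ext_famP (F G : I -> V) a x :
  lin_ext (fun k => a *: F k + G k) x = a *: lin_ext F x + lin_ext G x.
Proof.
rewrite /lin_ext scaler_sumr -big_split /=; apply: eq_bigr => k _.
by rewrite scalerDr !scalerA mulrC.
Qed.

Lemma malg_ind (P : {malg K[I]} -> Prop) :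
  P 0 -> (forall a k x, P x -> P (a *: << k >> + x)) -> forall x, P x.
Proof.
move=> P0 PS x; rewrite [x]monalgE; elim/big_rec: _ => // k y _ Py.
suff -> : << x@_k *g k >> = x@_k *: (<< k >> : {malg K[I]}) by apply: PS.
by apply/malgP => j; rewrite mcoeffZ !mcoeffU mulrnAr mulr1.
Qed.

End LinearExtension.

(* Any bilinear bracket satisfying the relations of W(0,1) on a spanning family
   (L_m), (W_m) is a Lie bracket. *)
Section W01Relations.
Variables (K : numFieldType) (V : lmodType K) (L W : int -> V).
Variable B : V -> V -> V.
Hypothesis span : forall P : V -> Prop, P 0 ->
  (forall a m x, P x -> P (a *: L m + x)) ->
  (forall a m x, P x -> P (a *: W m + x)) -> forall x, P x.
Hypothesis BPl : forall a x y z, B (a *: x + y) z = a *: B x z + B y z.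
Hypothesis BPr : forall a x y z, B x (a *: y + z) = a *: B x y + B x z.
Hypothesis BLL : forall m n, B (L m) (L n) = (n - m)%:~R *: L (m + n).
Hypothesis BLW : forall m n, B (L m) (W n) = (n + m)%:~R *: W (m + n).
Hypothesis BWL : forall m n, B (W m) (L n) = - ((m + n)%:~R *: W (n + m)).
Hypothesis BWW : forall m n, B (W m) (W n) = 0.

Let B0l x : B 0 x = 0.
Proof.
have := BPl 1 0 0 x; rewrite !scale1r addr0 => e.
by apply: (addrI (B 0 x)); rewrite -e addr0.
Qed.

Let B0r x : B x 0 = 0.
Proof.
have := BPr 1 x 0 0; rewrite !scale1r addr0 => e.
by apply: (addrI (B x 0)); rewrite -e addr0.
Qed.

Let BZl a x y : B (a *: x) y = a *: B x y.
Proof. by rewrite -[a *: x]addr0 BPl B0l addr0. Qed.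

Let BZr a x y : B x (a *: y) = a *: B x y.
Proof. by rewrite -[a *: y]addr0 BPr B0r addr0. Qed.

Let BNr x y : B x (- y) = - B x y.
Proof. by rewrite -scaleN1r BZr scaleN1r. Qed.

Lemma W01_rel_antisym x y : B x y = - B y x.
Proof.
have stepl u z a v : B u z = - B z u -> B v z = - B z v ->
    B (a *: u + v) z = - B z (a *: u + v).
  by move=> eu ev; rewrite BPl BPr eu ev opprD scalerN.
have stepr u z a v : B z u = - B u z -> B z v = - B v z ->
    B z (a *: u + v) = - B (a *: u + v) z.
  by move=> eu ev; rewrite BPl BPr eu ev opprD scalerN.
elim/span: x => [|a m x IH|a m x IH]; first by rewrite B0l B0r oppr0.
- apply: stepl => // {IH x a}.
  elim/span: y => [|a n y IH|a n y IH]; first by rewrite B0l B0r oppr0.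
  + by apply: stepr => //; rewrite !BLL -scaleNr -rmorphN opprB [n + m]addrC.
  + by apply: stepr => //; rewrite BLW BWL opprK.
- apply: stepl => // {IH x a}.
  elim/span: y => [|a n y IH|a n y IH]; first by rewrite B0l B0r oppr0.
  + by apply: stepr => //; rewrite BLW BWL.
  + by apply: stepr => //; rewrite !BWW oppr0.
Qed.

Lemma W01_rel_alternating x : B x x = 0.
Proof.
have /eqP : B x x *+ 2 = 0 by rewrite mulr2n {1}W01_rel_antisym addNr.
rewrite -scaler_nat => /eqP e2.
by rewrite -[LHS]scale1r -(@mulVf K 2) ?pnatr_eq0 // -scalerA e2 scaler0.
Qed.

Let J x y z := B x (B y z) + B y (B z x) + B z (B x y).

Let JC x y z : J x y z = J y z x.
Proof. by rewrite /J -addrA addrC. Qed.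

Let JP a x y z t : J (a *: x + y) z t = a *: J x z t + J y z t.
Proof.
rewrite /J !(BPl, BPr) !scalerDr.
by rewrite [X in X + _ = _]addrACA [LHS]addrACA.
Qed.

Let J0 y z : J 0 y z = 0.
Proof. by rewrite /J !(B0l, B0r) !addr0. Qed.

Let J_span (P : V -> V -> Prop) :
    (forall m y z, P y z -> J (L m) y z = 0) ->
    (forall m y z, P y z -> J (W m) y z = 0) ->
  forall x y z, P y z -> J x y z = 0.
Proof.
move=> HL HW x y z Pyz; elim/span: x => [|a m x IH|a m x IH]; first exact: J0.
- by rewrite JP IH HL // scaler0 addr0.
- by rewrite JP IH HW // scaler0 addr0.
Qed.

Let gen x := exists m, x = L m \/ x = W m.

Let JLLL m n p : J (L m) (L n) (L p) = 0.
Proof.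
rewrite /J !(BLL, BZr) !scalerA.
have -> : n + (p + m) = m + (n + p) by ring.
have -> : p + (m + n) = m + (n + p) by ring.
rewrite -!scalerDl -!intrM -!intrD.
set c := (X in X%:~R); have -> : c = 0 by rewrite /c; ring.
by rewrite scale0r.
Qed.

Let JLLW m n p : J (L m) (L n) (W p) = 0.
Proof.
rewrite /J !(BLL, BLW, BWL, BNr, BZr) -!scaleNr !scalerA.
have -> : n + (m + p) = m + (n + p) by ring.
have -> : m + n + p = m + (n + p) by ring.
rewrite -?rmorphN -?intrM -?scaleNr -!scalerDl -!intrD.
set c := (X in X%:~R); have -> : c = 0 by rewrite /c; ring.
by rewrite scale0r.
Qed.

Let JgW x m n : gen x -> J x (W m) (W n) = 0.
Proof.
by case=> p [] ->; rewrite /J !(BLW, BWL, BWW, BNr, BZr, B0r, scaler0, oppr0, addr0).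
Qed.

Let J_gen x y z : gen x -> gen y -> gen z -> J x y z = 0.
Proof.
move=> gx gy gz; case: (gx) (gy) (gz) => m [] -> [n [] ->] [p [] ->].
- exact: JLLL.
- exact: JLLW.
- by rewrite -JC JLLW.
- by apply: JgW; exists m; left.
- by rewrite JC JLLW.
- by rewrite JC; apply: JgW; exists n; left.
- by rewrite -JC; apply: JgW; exists p; left.
- by apply: JgW; exists m; right.
Qed.

Let genL m : gen (L m). Proof. by exists m; left. Qed.
Let genW m : gen (W m). Proof. by exists m; right. Qed.

Lemma W01_rel_jacobi x y z : B x (B y z) + B y (B z x) + B z (B x y) = 0.
Proof.
suff: J x y z = 0 by [].
have J1 u v w : gen v -> gen w -> J u v w = 0.
  move=> gv gw; apply: (@J_span (fun v w => gen v /\ gen w)) => // m ? ? [? ?];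
  exact: J_gen.
have J2 u v w : gen v -> J u v w = 0.
  move=> gv; rewrite -JC.
  by apply: (@J_span (fun _ v => gen v)) => // m ? ? ?; rewrite JC; apply: J1.
by apply: (@J_span (fun _ _ => True)) => // m ? ? _; rewrite -JC; apply: J2.
Qed.

End W01Relations.

(* [inl m] indexes the basis vector L_m and [inr m] the basis vector W_m. *)
Definition W01 (K : numFieldType) : Type := {malg K[(int + int)%type]}.

Section W01Algebra.
Variable K : numFieldType.

HB.instance Definition _ := GRing.Lmodule.copy (W01 K) {malg K[(int + int)%type]}.

Definition W01_L (m : int) : W01 K := << inl m >>.
Definition W01_W (m : int) : W01 K := << inr m >>.

Definition W01_basis_bracket (k l : int + int) : W01 K :=
  match k, l with
  | inl m, inl n => (n - m)%:~R *: W01_L (m + n)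
  | inl m, inr n => (n + m)%:~R *: W01_W (m + n)
  | inr m, inl n => - ((m + n)%:~R *: W01_W (n + m))
  | inr _, inr _ => 0
  end.

Definition W01_bracket (x y : W01 K) : W01 K :=
  lin_ext (fun k => lin_ext (W01_basis_bracket k) y) x.

Lemma W01_bracketPl a x y z :
  W01_bracket (a *: x + y) z = a *: W01_bracket x z + W01_bracket y z.
Proof. exact: lin_extP. Qed.

Lemma W01_bracketPr a x y z :
  W01_bracket x (a *: y + z) = a *: W01_bracket x y + W01_bracket x z.
Proof.
rewrite /W01_bracket -lin_ext_famP; congr (lin_ext _ x).
by apply: funext => k; rewrite lin_extP.
Qed.

Lemma W01_bracketU k l :
  W01_bracket << k >> << l >> = W01_basis_bracket k l.
Proof. by rewrite /W01_bracket !lin_extU. Qed.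

Lemma W01_bracketLL m n :
  W01_bracket (W01_L m) (W01_L n) = (n - m)%:~R *: W01_L (m + n).
Proof. exact: W01_bracketU. Qed.

Lemma W01_bracketLW m n :
  W01_bracket (W01_L m) (W01_W n) = (n + m)%:~R *: W01_W (m + n).
Proof. exact: W01_bracketU. Qed.

Lemma W01_bracketWL m n :
  W01_bracket (W01_W m) (W01_L n) = - ((m + n)%:~R *: W01_W (n + m)).
Proof. exact: W01_bracketU. Qed.

Lemma W01_bracketWW m n : W01_bracket (W01_W m) (W01_W n) = 0.
Proof. exact: W01_bracketU. Qed.

Lemma W01_ind (P : W01 K -> Prop) : P 0 ->
  (forall a m x, P x -> P (a *: W01_L m + x)) ->
  (forall a m x, P x -> P (a *: W01_W m + x)) -> forall x, P x.
Proof. by move=> P0 PL PW; apply: malg_ind => // a [] m; [apply: PL|apply: PW]. Qed.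

Lemma W01_bracketxx x : W01_bracket x x = 0.
Proof.
exact: (W01_rel_alternating W01_ind W01_bracketPl W01_bracketPr
  W01_bracketLL W01_bracketLW W01_bracketWL W01_bracketWW).
Qed.

Lemma W01_jacobi x y z :
  W01_bracket x (W01_bracket y z) + W01_bracket y (W01_bracket z x)
    + W01_bracket z (W01_bracket x y) = 0.
Proof.
exact: (W01_rel_jacobi W01_ind W01_bracketPl W01_bracketPr
  W01_bracketLL W01_bracketLW W01_bracketWL W01_bracketWW).
Qed.

HB.instance Definition _ := Lmodule_isLieAlgebra.Build K (W01 K)
  W01_bracketPl W01_bracketPr W01_bracketxx W01_jacobi.

End W01Algebra.

Section W01ModuleRelations.
Variables (K : numFieldType) (V : lmodType K) (A : W01 K -> V -> V).
Hypothesis APl : forall a x y v, A (a *: x + y) v = a *: A x v + A y v.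
Hypothesis APr : forall a x u v, A x (a *: u + v) = a *: A x u + A x v.
Hypothesis ALL : forall m n v,
  A (W01_L K m) (A (W01_L K n) v) - A (W01_L K n) (A (W01_L K m) v)
    = (n - m)%:~R *: A (W01_L K (m + n)) v.
Hypothesis ALW : forall m n v,
  A (W01_L K m) (A (W01_W K n) v) - A (W01_W K n) (A (W01_L K m) v)
    = (n + m)%:~R *: A (W01_W K (m + n)) v.
Hypothesis AWW : forall m n v,
  A (W01_W K m) (A (W01_W K n) v) = A (W01_W K n) (A (W01_W K m) v).

Let A0l v : A 0 v = 0.
Proof.
have := APl 1 0 0 v; rewrite !scale1r addr0 => e.
by apply: (addrI (A 0 v)); rewrite -e addr0.
Qed.

Let A0r x : A x 0 = 0.
Proof.
have := APr 1 x 0 0; rewrite !scale1r addr0 => e.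
by apply: (addrI (A x 0)); rewrite -e addr0.
Qed.

Let AZl a x v : A (a *: x) v = a *: A x v.
Proof. by rewrite -[a *: x]addr0 APl A0l addr0. Qed.

Let ANl x v : A (- x) v = - A x v.
Proof. by rewrite -(scaleN1r x) AZl scaleN1r. Qed.

Lemma W01_rel_module x y v :
  A (lie_bracket x y) v = A x (A y v) - A y (A x v).
Proof.
pose D x y := A (lie_bracket x y) v - (A x (A y v) - A y (A x v)).
suff: D x y = 0 by move/eqP; rewrite subr_eq0 => /eqP.
have comb a (p q r p' q' r' : V) :
    a *: p + p' - (a *: q + q' - (a *: r + r'))
    = a *: (p - (q - r)) + (p' - (q' - r')).
  have sw x1 x2 x3 x4 : x1 + x2 - (x3 + x4) = x1 - x3 + (x2 - x4) :> V.
    by rewrite opprD addrACA.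
  by rewrite (sw (a *: q)) (sw (a *: p)) -!scalerBr.
have Dl a u w z : D (a *: u + w) z = a *: D u z + D w z.
  by rewrite /D lie_bracketPl !APl APr comb.
have Dr a u w z : D z (a *: u + w) = a *: D z u + D z w.
  by rewrite /D lie_bracketPr !APl APr comb.
have D0l z : D 0 z = 0.
  have := Dl 1 0 0 z; rewrite !scale1r addr0 => e.
  by apply: (addrI (D 0 z)); rewrite -e addr0.
have D0r z : D z 0 = 0.
  have := Dr 1 0 0 z; rewrite !scale1r addr0 => e.
  by apply: (addrI (D z 0)); rewrite -e addr0.
have DLL m n : D (W01_L K m) (W01_L K n) = 0.
  by rewrite /D [lie_bracket _ _]W01_bracketLL AZl ALL subrr.
have DLW m n : D (W01_L K m) (W01_W K n) = 0.
  by rewrite /D [lie_bracket _ _]W01_bracketLW AZl ALW subrr.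
have DWL m n : D (W01_W K m) (W01_L K n) = 0.
  by rewrite /D [lie_bracket _ _]W01_bracketWL ANl AZl -ALW opprB subrr.
have DWW m n : D (W01_W K m) (W01_W K n) = 0.
  by rewrite /D [lie_bracket _ _]W01_bracketWW A0l AWW subrr subrr.
elim/W01_ind: x => [|a m x IH|a m x IH]; first exact: D0l.
- rewrite Dl IH addr0 -[RHS](scaler0 _ a); congr (_ *: _) => {IH x a}.
  elim/W01_ind: y => [|a n y IH|a n y IH]; first exact: D0r.
  + by rewrite Dr IH DLL scaler0 addr0.
  + by rewrite Dr IH DLW scaler0 addr0.
- rewrite Dl IH addr0 -[RHS](scaler0 _ a); congr (_ *: _) => {IH x a}.
  elim/W01_ind: y => [|a n y IH|a n y IH]; first exact: D0r.
  + by rewrite Dr IH DWL scaler0 addr0.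
  + by rewrite Dr IH DWW scaler0 addr0.
Qed.

End W01ModuleRelations.

(* C[s,t] is {poly {poly K}}, with outer variable s and inner variable t;
   the proof of lambda != 0 is a parameter because Theta(lambda, h) is not a
   module for lambda = 0. *)
Definition Theta (K : numFieldType) (lambda : K) (lambda_neq0 : lambda != 0)
  (h : {poly K}) : Type := {poly {poly K}}.

Section ThetaModule.
Variables (K : numFieldType) (lambda : K) (lambda_neq0 : lambda != 0).
Variable h : {poly K}.
Local Notation Th := (Theta lambda_neq0 h).

HB.instance Definition _ := GRing.Zmodule.copy Th {poly {poly K}}.

Definition Theta_scale (c : K) (f : Th) : Th := c%:P%:P * (f : {poly {poly K}}).

Fact Theta_scaleA c1 c2 f :
  Theta_scale c1 (Theta_scale c2 f) = Theta_scale (c1 * c2) f.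
Proof. by rewrite /Theta_scale !polyCM mulrA. Qed.

Fact Theta_scale1 : left_id 1 Theta_scale.
Proof. by move=> f; rewrite /Theta_scale !polyC1 mul1r. Qed.

Fact Theta_scaleDr : right_distributive Theta_scale +%R.
Proof. by move=> c f g; rewrite /Theta_scale mulrDr. Qed.

Fact Theta_scaleDl f : {morph Theta_scale^~ f : a b / a + b}.
Proof. by move=> a b; rewrite /Theta_scale !polyCD mulrDl. Qed.

HB.instance Definition _ := GRing.Zmodule_isLmodule.Build K Th
  Theta_scaleA Theta_scale1 Theta_scaleDr Theta_scaleDl.

Lemma Theta_scaleE (c : K) (f : Th) :
  c *: f = (c%:P%:P * (f : {poly {poly K}}) : {poly {poly K}}).
Proof. by []. Qed.

Definition Theta_L (m : int) (f : {poly {poly K}}) : {poly {poly K}} :=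
  (lambda ^ m)%:P%:P * ('X + (m%:~R * h)%:P) * (f \Po ('X - m%:~R%:P)).

Definition Theta_W (m : int) (f : {poly {poly K}}) : {poly {poly K}} :=
  if m == 0 then 'X%:P * f else 0.

Definition Theta_basis_act (f : Th) (k : int + int) : Th :=
  match k with inl m => Theta_L m f | inr m => Theta_W m f end.

Definition Theta_act (x : W01 K) (f : Th) : Th := lin_ext (Theta_basis_act f) x.

Lemma Theta_actPl a x y f :
  Theta_act (a *: x + y) f = a *: Theta_act x f + Theta_act y f.
Proof. exact: lin_extP. Qed.

Lemma Theta_LP (a : K) m f g :
  Theta_L m (a%:P%:P * f + g) = a%:P%:P * Theta_L m f + Theta_L m g.
Proof. by rewrite /Theta_L comp_polyD comp_polyM comp_polyC; ring. Qed.

Lemma Theta_WP (a : K) m f g :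
  Theta_W m (a%:P%:P * f + g) = a%:P%:P * Theta_W m f + Theta_W m g.
Proof. by rewrite /Theta_W; case: eqP => _; ring. Qed.

Lemma Theta_actPr a x f g :
  Theta_act x (a *: f + g) = a *: Theta_act x f + Theta_act x g.
Proof.
rewrite /Theta_act -lin_ext_famP; congr (lin_ext _ x).
by apply: funext => -[] m; [exact: Theta_LP|exact: Theta_WP].
Qed.

Lemma Theta_actL m f : Theta_act (W01_L K m) f = Theta_L m f.
Proof. exact: lin_extU. Qed.

Lemma Theta_actW m f : Theta_act (W01_W K m) f = Theta_W m f.
Proof. exact: lin_extU. Qed.

Lemma Theta_LE m n f : Theta_L m (Theta_L n f) =
  (lambda ^ (m + n))%:P%:P * ('X + (m%:~R * h)%:P)
    * ('X - m%:~R%:P + (n%:~R * h)%:P) * (f \Po ('X - (m + n)%:~R%:P)).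
Proof.
rewrite /Theta_L !comp_polyM comp_polyD comp_polyX !comp_polyC -comp_polyA.
rewrite comp_polyB comp_polyX comp_polyC.
have -> : 'X - m%:~R%:P - n%:~R%:P = 'X - (m + n)%:~R%:P :> {poly {poly K}}.
  by rewrite -addrA -opprD -polyCD -intrD.
by rewrite expfzDr // !polyCM; ring.
Qed.

Lemma Theta_LL m n f :
  Theta_L m (Theta_L n f) - Theta_L n (Theta_L m f)
    = (n - m)%:~R%:P%:P * Theta_L (m + n) f.
Proof.
rewrite !Theta_LE [n + m]addrC /Theta_L.
set g := f \Po _; set l := (lambda ^ _)%:P%:P.
rewrite !intrD !intrN !polyCM !polyCD !polyCN.
have C2 (k : int) : k%:~R%:P%:P = k%:~R :> {poly {poly K}} by rewrite !rmorph_int.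
have C (k : int) : k%:~R%:P = k%:~R :> {poly {poly K}} by rewrite rmorph_int.
rewrite ?C2 !C; ring.
Qed.

Lemma Theta_LW m n f :
  Theta_L m (Theta_W n f) - Theta_W n (Theta_L m f)
    = (n + m)%:~R%:P%:P * Theta_W (m + n) f.
Proof.
have -> : (n + m)%:~R%:P%:P * Theta_W (m + n) f = 0 :> {poly {poly K}}.
  rewrite /Theta_W addrC; case: eqP => [->|_]; last by rewrite mulr0.
  by rewrite !polyC0 mul0r.
rewrite /Theta_W; case: eqP => _; last by rewrite /Theta_L comp_poly0 mulr0 subr0.
by rewrite /Theta_L comp_polyM comp_polyC; ring.
Qed.

Lemma Theta_WW m n f : Theta_W m (Theta_W n f) = Theta_W n (Theta_W m f).
Proof. by rewrite /Theta_W; do 2!case: eqP => _; rewrite ?mulr0. Qed.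

Lemma Theta_act_bracket x y f :
  Theta_act (lie_bracket x y) f
    = Theta_act x (Theta_act y f) - Theta_act y (Theta_act x f).
Proof.
apply: (W01_rel_module Theta_actPl Theta_actPr) => m n v.
- by rewrite !Theta_actL; exact: Theta_LL.
- by rewrite !Theta_actL !Theta_actW; exact: Theta_LW.
- by rewrite !Theta_actW; exact: Theta_WW.
Qed.

HB.instance Definition _ := Lmodule_isLieModule.Build K (W01 K) Th
  Theta_actPl Theta_actPr Theta_act_bracket.

End ThetaModule.

(* Main.v *)
(* As L_0 and W_0 act by multiplication by s and t, a submodule M is an ideal of
   C[s,t].  For f in M, L_m f is lambda^m times a polynomial in m, so M contains
   each of its coefficients, i.e. all h f^(j)/j! - s f^(j+1)/(j+1)! up to sign.
   For f = a s^(n+1) + b s^n + ... the two top ones give h a and h b - s a in M,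
   and by induction on the degree every coefficient a_i(t) of f satisfies
   s a_i in M (i >= 1), together with a_0 in M.  Hence M is determined by the
   two ideals {a | a in M} and {a | s a in M} of C[t], which are principal. *)
Require Import Defs.
From HB Require Import structures.
From mathcomp Require Import all_boot all_order all_algebra.
From mathcomp Require Import boolp classical_sets reals complex.
From mathcomp Require Import ring.

Set Implicit Arguments.
Unset Strict Implicit.
Unset Printing Implicit Defensive.

Import GRing.Theory Num.Theory.
Local Open Scope ring_scope.
Local Open Scope classical_set_scope.

(** * Ideals of commutative rings as sets, and polynomial tools *)

Definition ideal_set (A : comNzRingType) (I : set A) : Prop :=
  [/\ I 0, forall u v, I u -> I v -> I (u + v) & forall a u, I u -> I (a * u)].

Section IdealSet.
Variables (A : comNzRingType) (I : set A).
Hypothesis idI : ideal_set I.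

Lemma ideal_setD u v : I u -> I v -> I (u + v).
Proof. by case: idI => _ + _; apply. Qed.

Lemma ideal_setM a u : I u -> I (a * u).
Proof. by case: idI => _ _; apply. Qed.

Lemma ideal_setN u : I u -> I (- u).
Proof. by rewrite -mulN1r; apply: ideal_setM. Qed.

Lemma ideal_setB u v : I u -> I v -> I (u - v).
Proof. by move=> Iu Iv; apply: ideal_setD => //; apply: ideal_setN. Qed.

Lemma ideal_set_sum (n : nat) (P : pred 'I_n) (F : 'I_n -> A) :
  (forall i, P i -> I (F i)) -> I (\sum_(i < n | P i) F i).
Proof. by case: idI => I0 ID _ IF; elim/big_ind: _. Qed.

(* If q.[k] is in I, then q - q.[k] = r * ('X - k) and r.[m] * (m - k) is in I for
   all m > k, so one may descend to r and k + 1. *)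
Lemma ideal_set_coef (divn : forall (n : nat) u, I (n.+1%:R * u) -> I u)
    (k : nat) (q : {poly A}) :
  (forall m : nat, (k <= m)%N -> I q.[m%:R]) -> forall i, I q`_i.
Proof.
have [n] := ubnP (size q); elim: n k q => // n IHn k q.
rewrite ltnS => sq Iq.
have [sq1|sq1] := leqP (size q) 1.
  have := Iq k (leqnn k); rewrite (size1_polyC sq1) hornerC => Iq0 [|i].
    by rewrite coefC.
  by rewrite coefC; case: idI.
have [r Er] : exists r, q - q.[k%:R]%:P = r * ('X - k%:R%:P).
  by apply/factor_theorem; rewrite /root hornerD hornerN hornerC subrr.
have Eq : q = r * ('X - k%:R%:P) + q.[k%:R]%:P by rewrite -Er subrK.
have Ir i : I r`_i.
  apply: (IHn k.+1).
    have [->|r0] := eqVneq r 0; first by rewrite size_poly0 (leq_trans (ltnW sq1) sq).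
    have : (size (q - q.[k%:R]%:P)%R <= size q)%N.
      rewrite (leq_trans (size_polyD _ _)) // geq_max leqnn size_polyN.
      by rewrite (leq_trans (size_polyC_leq1 _)) // ltnW.
    by rewrite Er size_Mmonic ?monicXsubC // size_XsubC addn2 /= => /leq_trans; apply.
  (* Here q.[m] - q.[k] = (m - k) r.[m], and m - k > 0 is rewritten as a successor to fit [divn]. *)
  move=> m km; apply: (divn (m - k).-1).
  have -> : (m - k).-1.+1 = (m - k)%N by rewrite prednK // subn_gt0.
  have := ideal_setB (Iq m (ltnW km)) (Iq k (leqnn k)).
  rewrite {1}Eq !hornerE natrB ?(ltnW km) // mulrC.
  by rewrite addrK.
move=> i; rewrite Eq coefD mulrBr coefB coefMX coefMC coefC.
apply: ideal_setD; last by case: eqP => _; [apply: Iq | case: idI].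
apply: ideal_setB; first by case: eqP => _; [case: idI | apply: Ir].
by rewrite mulrC; apply: ideal_setM.
Qed.

End IdealSet.

(** Euclidean division: a nonzero element [g] of least size works, since a nonzero remainder modulo
    [g] would be a smaller element of [I]. For the zero ideal the generator is 0. *)
Lemma poly_ideal_principal (K : fieldType) (I : set {poly K}) :
  ideal_set I -> exists2 g, I g & forall a, I a -> g %| a.
Proof.
move=> idI; have [I0 _ _] := idI.
have [[b Ib b0]|none] := pselect (exists2 b, I b & b != 0); last first.
  exists 0 => // a Ia; rewrite dvd0p; apply/negPn/negP => a0.
  by apply: none; exists a.
pose P n := `[< exists b, [/\ I b, b != 0 & size b = n] >].
have exP : exists n, P n by exists (size b); apply/asboolP; exists b.
case: (ex_minnP exP) => n /asboolP[g [Ig g0 <-]] gmin.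
exists g => // a Ia; apply/negPn/negP => ga.
have : ~~ P (size (a %% g)).
  by apply/negP => /gmin; rewrite leqNgt ltn_modp g0.
move/negP; apply.
apply/asboolP; exists (a %% g); split=> //.
have -> : a %% g = a - a %/ g * g by rewrite {2}(divp_eq a g) addrC addKr.
by apply: ideal_setB => //; apply: ideal_setM.
Qed.

(** Composition is evaluation over [{poly A}], expanded here around ['X], where each divided
    derivative evaluates to itself. With q = -m this makes L_m f polynomial in m, up to lambda^m. *)
Lemma comp_poly_taylor (A : comNzRingType) (p q : {poly A}) :
  p \Po ('X + q) = \sum_(i < size p) p^`N(i) * q ^+ i.
Proof.
rewrite /comp_poly (nderiv_taylor _ (mulrC _ _)) size_map_polyC.
apply: eq_bigr => i _; rewrite nderivn_map; congr (_ * _).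
exact: comp_polyXr.
Qed.

(** * Generated submodules and sums of submodules *)

Section Submodules.
Variables (K : fieldType) (L : lieAlgType K) (V : lieModType L).
Implicit Types (M N : set V) (v : V).

Lemma generated_submodule_sub M v :
  lie_submodule M -> M v -> generated_submodule v `<=` M.
Proof. by move=> sM Mv; apply: smallest_sub => // _ ->. Qed.

Lemma lie_submodule_generated v : lie_submodule (generated_submodule v).
Proof.
split.
- by move=> M [[]].
- move=> a u w gu gw M MP; case: (MP) => [[_ ML _] _].
  by apply: ML; [exact: gu|exact: gw].
- by move=> x u gu M MP; case: (MP) => [[_ _ MA] _]; apply: MA; exact: gu.
Qed.

Lemma mem_generated_submodule v : generated_submodule v v.
Proof. by move=> M [_]; apply. Qed.

Lemma lie_submodule_sum M N :
  lie_submodule M -> lie_submodule N -> lie_submodule (submodule_sum M N).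
Proof.
move=> [M0 ML MA] [N0 NL NA]; split.
- by exists 0 => //; exists 0 => //; rewrite addr0.
- move=> a _ _ [u Mu [v Nv <-]] [u' Mu' [v' Nv' <-]].
  exists (a *: u + u'); first exact: ML.
  exists (a *: v + v'); first exact: NL.
  by rewrite scalerDr addrACA.
- move=> x _ [u Mu [v Nv <-]].
  exists (lie_act x u); first exact: MA.
  exists (lie_act x v); first exact: NA.
  by rewrite -[u in RHS]scale1r lie_actPr scale1r.
Qed.

Lemma submodule_sum_sub M N Q : lie_submodule Q ->
  M `<=` Q -> N `<=` Q -> submodule_sum M N `<=` Q.
Proof.
move=> [_ QL _] MQ NQ _ [u Mu [v Nv <-]].
by rewrite -[u]scale1r; apply: QL; [exact: MQ|exact: NQ].
Qed.

End Submodules.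

(** * Submodules of Theta: ideal structure and extraction of coefficients *)

Section ThetaSubmodules.
Variables (K : numFieldType) (lambda : K) (lambda_neq0 : lambda != 0).
Variable h : {poly K}.
Local Notation Th := (Theta lambda_neq0 h).

Lemma Theta_submodule_ideal (M : set Th) :
  lie_submodule M -> ideal_set (M : set {poly {poly K}}).
Proof.
move=> [M0 ML MA].
have MD u v : M u -> M v -> M (u + v).
  by move=> Mu Mv; rewrite -[u]scale1r; apply: ML.
have MC c u : M u -> M (c%:P%:P * u : {poly {poly K}}).
  by move=> Mu; have := ML c u 0 Mu M0; rewrite addr0.
have Ms u : M u -> M (u * 'X : {poly {poly K}}).
  move=> /(MA (W01_L K 0)); rewrite /lie_act /= Theta_actL /Theta_L.
  by rewrite mulr0z mul0r expr0z subr0 comp_polyXr addr0 mul1r mulrC.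
have Mt u : M u -> M ('X%:P * u : {poly {poly K}}).
  by move=> /(MA (W01_W K 0)); rewrite /lie_act /= Theta_actW /Theta_W eqxx.
(* Induction on the multiplier as a polynomial in s, then on its coefficients as polynomials in
   t. *)
split=> // a u Mu; elim/poly_ind: a => [|a c IHa]; first by rewrite mul0r.
rewrite mulrDl mulrAC; apply: (MD); first exact: Ms.
elim/poly_ind: c => [|c d IHc]; first by rewrite mul0r.
rewrite polyCD polyCM mulrDl -mulrA mulrCA.
by apply: MD; [apply: Mt | apply: MC].
Qed.

(** Up to the sign (-1)^j this is the coefficient of m^(j+1) in lambda^(-m) L_m f = (s + m h) sum_i
    (-m)^i f^(i)/i!, with derivatives in s. *)
Lemma Theta_submodule_nderivn (M : set Th) (f : {poly {poly K}}) (j : nat) :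
  lie_submodule M -> M f -> M (h%:P * f^`N(j) - 'X * f^`N(j.+1)).
Proof.
move=> sM Mf; have idM := Theta_submodule_ideal sM.
(* The new outermost variable stands for m, so that [q.[m%:R]] is lambda^(-m) L_m f. *)
pose q : {poly {poly {poly K}}} :=
  ('X%:P + h%:P *: 'X) * \poly_(i < size f) ((-1) ^+ i * f^`N(i)).
(* Valid for every i, as the divided derivatives vanish beyond the degree of [f]. *)
have cq i : (\poly_(i < size f) ((-1) ^+ i * f^`N(i)))`_i = (-1) ^+ i * f^`N(i).
  rewrite coef_poly; case: ltnP => // sf.
  by rewrite nderivn_poly0 // mulr0.
have /(_ j.+1) : forall i, M q`_i.
  apply: (ideal_set_coef idM _ (k := 0)).
    (* Division by n + 1 is possible inside M because K has characteristic 0. *)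
    move=> n u /(ideal_setM idM (n.+1%:R^-1)%:P%:P).
    rewrite mulrA.
    suff -> : (n.+1%:R^-1)%:P%:P * n.+1%:R = 1 :> {poly {poly K}} by rewrite mul1r.
    by rewrite -!polyC_natr -!polyCM mulVf ?pnatr_eq0.
  move=> m _; case: sM => _ _ /(_ (W01_L K m) f Mf).
  rewrite /lie_act /= Theta_actL /Theta_L.
  move=> /(ideal_setM idM (lambda ^ m)^-1%:P%:P).
  rewrite !mulrA -!polyCM mulVf ?expfz_neq0 // mul1r.
  suff -> : q.[m%:R] = ('X + (m%:~R * h)%:P) * (f \Po ('X - m%:~R%:P)) by [].
  rewrite /q hornerM; congr (_ * _).
    by rewrite hornerD hornerC hornerZ hornerX polyCM polyC_natr mulrC.
  rewrite comp_poly_taylor horner_poly; apply: eq_bigr => i _.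
  rewrite -polyCN.
  by rewrite mulrAC mulrC -exprMn mulN1r polyCN polyC_natr.
rewrite /q mulrDl coefD coefCM -scalerAl coefZ coefXM /= !cq.
move=> /(ideal_setM idM ((-1) ^+ j)).
suff -> : (-1) ^+ j * ('X * ((-1) ^+ j.+1 * f^`N(j.+1)) + h%:P * ((-1) ^+ j * f^`N(j)))
  = h%:P * f^`N(j) - 'X * f^`N(j.+1) by [].
have e : (-1) ^+ j * (-1) ^+ j = 1 :> {poly {poly K}}.
  by rewrite -expr2 sqrr_sign.
rewrite exprS; ring: e.
Qed.

(** The clause on h times a coefficient strengthens the induction: it yields h b in M, from which s
    a is obtained. *)
Lemma Theta_submodule_coef (M : set Th) (n : nat) (f : {poly {poly K}}) :
    lie_submodule M -> M f -> (size f <= n.+1)%N ->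
  M (f`_0)%:P /\
  forall i, M (h * f`_i.+1)%:P /\ M ('X * (f`_i.+1)%:P).
Proof.
move=> sM; have idM := Theta_submodule_ideal sM; have [M0 _ _] := idM.
elim: n f => [|n IHn] f Mf sf.
  split; first by rewrite -size1_polyC.
  by move=> i; rewrite (leq_sizeP _ _ sf) // mulr0 mulr0.
set a := f`_n.+1; set b := f`_n.
have fNS : f^`N(n.+1) = a%:P.
  apply/polyP => i; rewrite coef_nderivn coefC; case: i => [|i].
    by rewrite addn0 binn mulr1n.
  by rewrite (leq_sizeP _ _ sf) ?mul0rn // addnS ltnS leq_addr.
have Ha : M (h * a)%:P.
  have := Theta_submodule_nderivn n.+1 sM Mf.
  rewrite [f^`N(n.+2)]nderivn_poly0 // mulr0 subr0 polyCM.
  by rewrite fNS.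
(* The n-th divided derivative is b + (n + 1) a s, giving h b + (n + 1) s h a - s a in M; the middle
   term is a multiple of h a. *)
have Hba : M ((h * b)%:P - 'X * a%:P).
  have := Theta_submodule_nderivn n sM Mf.
  have -> : f^`N(n) = b%:P + 'X * (a *+ n.+1)%:P.
    apply/polyP => i; rewrite coef_nderivn coefD coefC coefXM coefC.
    case: i => [|[|i]]; rewrite ?addn0 ?binn ?mulr1n ?addr0 //=.
      by rewrite addn1 binSn add0r.
    by rewrite (leq_sizeP _ _ sf) ?mul0rn ?addr0 // -addSnnS -addSnnS leq_addr.
  rewrite fNS => Mn.
  have := ideal_setB idM Mn (ideal_setM idM ('X * n.+1%:R) Ha).
  rewrite !polyCM polyCMn.
  by congr M; ring.
(* Adding s^n (c - s a) cancels the leading term of f, so IHn applies; this is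
   used with c = h b, then with c = 0 once s a is known to be in M. *)
have cut c : M (c%:P - 'X * a%:P) ->
    M (f`_0 + c *+ (0 == n)%N)%:P /\ forall i, (i < n)%N ->
      M (h * (f`_i.+1 + c *+ (i.+1 == n)))%:P /\
      M ('X * (f`_i.+1 + c *+ (i.+1 == n))%:P).
  move=> Mu; pose f1 := f + 'X^n * (c%:P - 'X * a%:P).
  have cf1 j : f1`_j = f`_j + (c *+ (j == n) - a *+ (j == n.+1)).
    rewrite coefD coefXnM coefB coefXM !coefC.
    have [jn|] := ltnP j n; first by rewrite !ltn_eqF ?subr0 // ltnW.
    move=> /subnKC <-; set d := (j - n)%N.
    have -> : (n + d == n)%N = (d == 0)%N by rewrite -{2}[n]addn0 eqn_add2l.
    have -> : (n + d == n.+1)%N = (d == 1)%N by rewrite -[n.+1]addn1 eqn_add2l.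
    by rewrite addKn; case: d => [|[|d]].
  have Mf1 : M f1 by apply: ideal_setD => //; apply: ideal_setM.
  have sf1 : (size f1 <= n.+1)%N.
    apply/leq_sizeP => j nj; rewrite cf1 (gtn_eqF nj) sub0r.
    have [->|jn] := eqVneq j n.+1; first by rewrite mulr1n subrr.
    by rewrite (leq_sizeP _ _ sf) ?subr0 // ltn_neqAle eq_sym jn.
  have [IH0 IH] := IHn f1 Mf1 sf1.
  split; first by move: IH0; rewrite cf1 subr0.
  by move=> i ni; have := IH i; rewrite cf1 eqSS (ltn_eqF ni) subr0.
have Mhb : M (h * b)%:P.
  have Mhb1 : M (h * (b + h * b))%:P.
    have [IH0 IH] := cut _ Hba.
    have [n0|n_gt0] := posnP n.
      by rewrite polyCM; apply: ideal_setM; move: IH0; rewrite /b n0 mulr1n.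
    by have := IH n.-1; rewrite prednK // leqnn eqxx mulr1n => /(_ isT)[].
  have Mhhb : M (h * (h * b))%:P.
    have := ideal_setD idM (ideal_setM idM h%:P Hba) (ideal_setM idM 'X Ha).
    by rewrite !polyCM; congr M; ring.
  have := ideal_setB idM Mhb1 Mhhb.
  by rewrite -polyCB mulrDr addrK.
have Msa : M ('X * a%:P).
  by have := ideal_setB idM Mhb Hba; rewrite opprB addrC subrK.
have [IH0 IH] : M (f`_0)%:P /\ forall i, (i < n)%N ->
    M (h * f`_i.+1)%:P /\ M ('X * (f`_i.+1)%:P).
  have [|IH0 IH] := cut 0; first by rewrite polyC0 sub0r; apply: ideal_setN.
  split; first by move: IH0; rewrite mul0rn addr0.
  by move=> i /IH; rewrite mul0rn addr0.
split=> // i; have [/IH//|] := ltnP i n.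
rewrite leq_eqVlt => /predU1P[<-//|ni].
by rewrite (leq_sizeP _ _ sf) // mulr0 mulr0.
Qed.

End ThetaSubmodules.

Theorem theorem2p7 (R : realType) (lambda : R[i]) (lambda_neq0 : lambda != 0)
    (h : {poly R[i]}) :
  [set submodule_sum
         (generated_submodule (f%:P : Theta lambda_neq0 h))
         (generated_submodule ('X * g%:P : Theta lambda_neq0 h))
     | f in [set: {poly R[i]}] & g in [set: {poly R[i]}]]
  = [set M : set (Theta lambda_neq0 h) | lie_submodule M].
Proof.
apply/seteqP; split=> [_ [f _ [g _ <-]]|M sM] /=.
  by apply: lie_submodule_sum; apply: lie_submodule_generated.
have idM := Theta_submodule_ideal sM; have [M0 MD MM] := idM.
have [|f If fP] := @poly_ideal_principal _ [set a | M a%:P].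
  split=> // [u v Mu Mv|a u Mu] /=; first by rewrite polyCD; apply: MD.
  by rewrite polyCM; apply: MM.
have [|g Jg gP] := @poly_ideal_principal _ [set a | M ('X * a%:P)].
  split=> [|u v Mu Mv|a u Mu] /=; first by rewrite mulr0.
    by rewrite polyCD mulrDr; apply: MD.
  by rewrite polyCM mulrCA; apply: MM.
exists f => //; exists g => //; apply/seteqP; split.
  by apply: submodule_sum_sub => //; apply: generated_submodule_sub.
move=> p Mp; have [p0 pS] := Theta_submodule_coef sM Mp (leqnSn (size p)).
exists ((p`_0)%:P : {poly {poly R[i]}}).
  have /dvdpP[c ->] := fP _ p0; rewrite polyCM.
  have idf := Theta_submodule_ideal
    (lie_submodule_generated (f%:P : Theta lambda_neq0 h)).
  by apply: (ideal_setM idf); apply: mem_generated_submodule.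
exists ('X * \poly_(i < size p) p`_i.+1 : {poly {poly R[i]}}).
  have idg := Theta_submodule_ideal
    (lie_submodule_generated ('X * g%:P : Theta lambda_neq0 h)).
  rewrite poly_def mulr_sumr; apply: (ideal_set_sum idg) => i _.
  rewrite -mul_polyC mulrA [_ * 'X^i]mulrC; apply: (ideal_setM idg).
  have /dvdpP[c ->] := gP _ (pS i).2; rewrite polyCM mulrCA.
  by apply: (ideal_setM idg); apply: mem_generated_submodule.
apply/polyP => -[|i]; rewrite coefD coefC coefXM /= ?addr0 // add0r coef_poly.
by case: ltnP => // pi; rewrite nth_default // ltnW.
Qed.
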